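(* Let $A\in\mathbb{R}^{m\times n}$ ($m\ge n$) have full column rank, $b\in\mathbb{R}^m$, and $x=\operatorname{argmin}_{x\in\mathbb{R}^n}\|b-Ax\|$. If $\widehat x$ is a backward stable solution to this least-squares problem, then $$\|A^\top(b-A\widehat x)\|\lesssim\|A\|\left(\|b\|+\|A\|\|\widehat x\|\right)u.$$ For a strongly forward stable method, this quantity can be as large as $$\|A^\top(b-A\widehat x)\|\gtrsim\|A\|\left(\|A\|\|x\|+\operatorname{cond}(A)\|b-Ax\|\right)u,$$ i.e. there exist strongly forward stable $\widehat x$ satisfying the latter bound.
   Context: $\|\cdot\|$ is the Euclidean norm of a vector or spectral norm of a matrix; $\|\cdot\|_{\rm F}$ is the Frobenius norm; $\operatorname{cond}(A)=\sigma_{\max}(A)/\sigma_{\min}(A)$; $u>0$ is the unit roundoff. $a\lesssim b$ (equivalently $b\gtrsim a$) means $a\le c(m,n)\,b$ for a prefactor $c(m,n)$ that is a polynomial in $m$ and $n$. Backward stability: the backward error of $\widehat x$ is $\mathrm{BE}(\widehat x)=\min\{\|\Delta A\|_{\rm F}: \widehat x=\operatorname{argmin}_{z\in\mathbb{R}^n}\|b-(A+\Delta A)z\|\}$; $\widehat x$ is backward stable if $\mathrm{BE}(\widehat x)\le c\,\|A\|_{\rm F}u$ with $c$ a polynomial in $m$ and $n$. Strong forward stability: $\widehat x$ is strongly forward stable if for some $\varepsilon\lesssim u$ both $\|x-\widehat x\|\le 2.23\operatorname{cond}(A)\left(\|x\|+\frac{\operatorname{cond}(A)}{\|A\|}\|b-Ax\|\right)\varepsilon$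 and $\|A(x-\widehat x)\|\le 2.23\left(\|A\|\|x\|+\operatorname{cond}(A)\|b-Ax\|\right)\varepsilon$. *)

(* Defs.v *)
From HB Require Import structures.
From mathcomp Require Import all_boot all_order all_algebra.
From mathcomp Require Import classical_sets reals.

Set Implicit Arguments.
Unset Strict Implicit.
Unset Printing Implicit Defensive.

Import Order.TTheory GRing.Theory Num.Theory.
Local Open Scope classical_set_scope.
Local Open Scope ring_scope.

(* MathComp-Analysis equips matrices with the entrywise maximum norm, so the
   Euclidean, spectral and Frobenius norms are defined here. *)
Section Norms.
Variable R : realType.

Definition norm2 n (v : 'cV[R]_n) : R := Num.sqrt (\sum_i v i 0 ^+ 2).

Definition normF m n (A : 'M[R]_(m, n)) : R :=
  Num.sqrt (\sum_i \sum_j A i j ^+ 2).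

(* The operator norm induced by norm2. *)
Definition spectral_norm m n (A : 'M[R]_(m, n)) : R :=
  sup [set norm2 (A *m v) | v in [set v : 'cV[R]_n | norm2 v <= 1]].

(* For m >= n, the singular values of A are the nonnegative square roots of
   the eigenvalues of the n x n matrix A^T A. *)
Definition singular_values m n (A : 'M[R]_(m, n)) : set R :=
  [set s | 0 <= s /\ eigenvalue (A^T *m A) (s ^+ 2)].

(* The set of singular values is finite, and nonempty for n > 0, so sup and
   inf are then its maximum and minimum. *)
Definition sigma_max m n (A : 'M[R]_(m, n)) : R := sup (singular_values A).

Definition sigma_min m n (A : 'M[R]_(m, n)) : R := inf (singular_values A).

Definition cond m n (A : 'M[R]_(m, n)) : R := sigma_max A / sigma_min A.

End Norms.

Section LeastSquares.
Variable R : realType.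

(* x belongs to argmin_z ||b - A z||; when A has full column rank, this
   determines x. *)
Definition ls_solution m n (A : 'M[R]_(m, n)) (b : 'cV[R]_m) (x : 'cV[R]_n) :=
  forall z : 'cV[R]_n, norm2 (b - A *m x) <= norm2 (b - A *m z).

(* The infimum is a minimum: the set of admissible D is closed, by the normal
   equations (A + D)^T (b - (A + D) xh) = 0, and it contains - A. *)
Definition backward_error m n (A : 'M[R]_(m, n)) (b : 'cV[R]_m)
    (xh : 'cV[R]_n) : R :=
  inf [set normF D | D in [set D : 'M[R]_(m, n) | ls_solution (A + D) b xh]].

(* c is a polynomial in the two dimensions m and n. *)
Definition lesssim (c : {poly {poly R}}) (m n : nat) (a b : R) : Prop :=
  a <= c.[(m%:R)%:P].[n%:R] * b.

Definition backward_stable (c : {poly {poly R}}) (u : R) m n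
    (A : 'M[R]_(m, n)) (b : 'cV[R]_m) (xh : 'cV[R]_n) : Prop :=
  lesssim c m n (backward_error A b xh) (normF A * u).

(* x stands for the exact least-squares solution. *)
Definition strongly_forward_stable (c : {poly {poly R}}) (u : R) m n
    (A : 'M[R]_(m, n)) (b : 'cV[R]_m) (x xh : 'cV[R]_n) : Prop :=
  exists eps : R,
    [/\ lesssim c m n eps u,
        norm2 (x - xh) <=
          (223 / 100) * cond A *
          (norm2 x + cond A / spectral_norm A * norm2 (b - A *m x)) * eps &
        norm2 (A *m (x - xh)) <=
          (223 / 100) *
          (spectral_norm A * norm2 x + cond A * norm2 (b - A *m x)) * eps].

End LeastSquares.

(* Main.v *)
Require Import Defs.
From mathcomp Require Import all_boot all_order all_algebra.
From mathcomp Require Import classical_sets reals.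
From mathcomp Require Import ring lra.
Import Order.TTheory GRing.Theory Num.Theory.
Local Open Scope ring_scope.

(** Backward stable half.  Let [r = b - A xh] and let [D] be any perturbation
    for which [xh] solves the perturbed problem.  The normal equations
    [(A + D)^T (b - (A + D) xh) = 0] rearrange to
      [A^T r = A^T (D xh) - D^T (b - (A + D) xh)],
    and the perturbed residual has norm at most [|b|], because [xh] does at
    least as well as [0].  Hence [|A^T r| <= |D|_F (|A| |xh| + |b|)]
    ([residual_le_perturbation]).  The right-hand side is monotone in [|D|_F],
    so [|D|_F] may be replaced by its infimum, the backward error
    ([residual_le_backward_error]).  The factor [n] in the final prefactor
    comes from [|A|_F <= n |A|].

    Strongly forward stable half.  The exact solution is perturbed along a top
    right singular vector: [xh = x + t v] with [A^T A v = |A|^2 v], [|v| = 1]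
    and [t = (|x| + cond A / |A| |b - A x|) u].  As [A^T (b - A x) = 0], one
    gets [|A^T (b - A xh)| = t |A|^2], which is exactly the announced lower
    bound; and [|x - xh| = t], [|A (x - xh)| = t |A|] satisfy both forward
    bounds with [eps = u], since [1 <= cond A].

    The second half needs a top singular vector, i.e. that the supremum
    defining [|A|] is attained.  The proof ([spectral_norm_eigenvalue]) is
    algebraic and uses no compactness: were [M = |A|^2 - A^T A] invertible, the
    nonnegative form of [M] would be bounded below by a positive multiple of
    [|w|^2], so [|A|] could be decreased. *)

Set Implicit Arguments.
Unset Strict Implicit.
Unset Printing Implicit Defensive.

(** * Euclidean inner product and norm *)

Section Euclidean.
Variable R : realType.
Implicit Types m n p : nat.

Definition dot n (v w : 'cV[R]_n) : R := \sum_i v i 0 * w i 0.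

Lemma dot_mx n (v w : 'cV[R]_n) : dot v w = (v^T *m w) 0 0.
Proof. by rewrite mxE; apply: eq_bigr => i _; rewrite mxE. Qed.

Lemma dotC n (v w : 'cV[R]_n) : dot v w = dot w v.
Proof. by apply: eq_bigr => i _; rewrite mulrC. Qed.

Lemma dotDl n (v v' w : 'cV[R]_n) : dot (v + v') w = dot v w + dot v' w.
Proof. by rewrite -big_split; apply: eq_bigr => i _; rewrite mxE mulrDl. Qed.

Lemma dotZl n a (v w : 'cV[R]_n) : dot (a *: v) w = a * dot v w.
Proof. by rewrite mulr_sumr; apply: eq_bigr => i _; rewrite mxE mulrA. Qed.

Lemma dotNl n (v w : 'cV[R]_n) : dot (- v) w = - dot v w.
Proof. by rewrite -scaleN1r dotZl mulN1r. Qed.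

Lemma dotDr n (v w w' : 'cV[R]_n) : dot v (w + w') = dot v w + dot v w'.
Proof. by rewrite dotC dotDl !(dotC v). Qed.

Lemma dotZr n a (v w : 'cV[R]_n) : dot v (a *: w) = a * dot v w.
Proof. by rewrite dotC dotZl dotC. Qed.

Lemma dotNr n (v w : 'cV[R]_n) : dot v (- w) = - dot v w.
Proof. by rewrite dotC dotNl dotC. Qed.

Definition dotE := (dotDl, dotDr, dotNl, dotNr, dotZl, dotZr).

Lemma dot_adjoint m n (A : 'M[R]_(m, n)) v w :
  dot (A *m v) w = dot v (A^T *m w).
Proof. by rewrite !dot_mx trmx_mul mulmxA. Qed.

Lemma dotvv_ge0 n (v : 'cV[R]_n) : 0 <= dot v v.
Proof. by apply: sumr_ge0 => i _; rewrite -expr2 sqr_ge0. Qed.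

Lemma dotvv_eq0 n (v : 'cV[R]_n) : dot v v = 0 -> v = 0.
Proof.
move=> v0; apply/matrixP => i j; rewrite ord1 mxE.
have sq_ge0 k : true -> 0 <= v k 0 * v k 0 by rewrite -expr2 sqr_ge0.
by have /eqP := psumr_eq0P sq_ge0 v0 (i := i) isT; rewrite mulf_eq0 orbb => /eqP.
Qed.

Lemma norm2_ge0 n (v : 'cV[R]_n) : 0 <= norm2 v.
Proof. exact: sqrtr_ge0. Qed.

Lemma norm2_sqr n (v : 'cV[R]_n) : norm2 v ^+ 2 = dot v v.
Proof.
have dotE' : \sum_i v i 0 ^+ 2 = dot v v by apply: eq_bigr => i _; rewrite expr2.
by rewrite /norm2 dotE' sqr_sqrtr ?dotvv_ge0.
Qed.

Lemma norm2_0 n : norm2 (0 : 'cV[R]_n) = 0.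
Proof.
apply/eqP; rewrite -sqrf_eq0 norm2_sqr.
by rewrite /dot big1 // => i _; rewrite mxE mul0r.
Qed.

Lemma norm2_gt0 n (v : 'cV[R]_n) : v != 0 -> 0 < norm2 v.
Proof.
move=> v0; rewrite lt_neqAle norm2_ge0 andbT eq_sym.
apply: contraNneq v0 => v0; apply/eqP/dotvv_eq0.
by rewrite -norm2_sqr v0 expr0n.
Qed.

Lemma norm2_le n (v : 'cV[R]_n) a : 0 <= a -> (norm2 v <= a) = (dot v v <= a ^+ 2).
Proof. by move=> a0; rewrite -norm2_sqr ler_pXn2r // nnegrE ?norm2_ge0. Qed.

Lemma norm2Z n a (v : 'cV[R]_n) : norm2 (a *: v) = `|a| * norm2 v.
Proof.
apply/eqP; rewrite -(eqrXn2 (n := 2)) ?mulr_ge0 ?norm2_ge0 //.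
by rewrite exprMn !norm2_sqr !dotE real_normK ?num_real // mulrA expr2.
Qed.

Lemma norm2N n (v : 'cV[R]_n) : norm2 (- v) = norm2 v.
Proof. by rewrite -scaleN1r norm2Z normrN1 mul1r. Qed.

(** Expanding [0 <= | |v|^2 w - (v, w) v |^2] gives
    [|v|^2 (v, w)^2 <= |v|^4 |w|^2]; dividing by [|v|^2] requires [v != 0]. *)
Lemma dot_sqr_le n (v w : 'cV[R]_n) : dot v w ^+ 2 <= dot v v * dot w w.
Proof.
have [->|v0] := eqVneq v 0.
  have d0 z : dot (0 : 'cV[R]_n) z = 0 by rewrite -[X in dot X](scale0r 0) dotZl mul0r.
  by rewrite !d0 expr0n mul0r.
have vv0 : 0 < dot v v by rewrite -norm2_sqr exprn_gt0 ?norm2_gt0.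
have := dotvv_ge0 (dot v v *: w - dot v w *: v).
rewrite !dotE (dotC w v) => h.
rewrite -(ler_pM2l vv0); nra.
Qed.

Lemma dot_le n (v w : 'cV[R]_n) : dot v w <= norm2 v * norm2 w.
Proof.
apply: le_trans (ler_norm _) _.
rewrite -(ler_pXn2r (n := 2)) ?nnegrE ?mulr_ge0 ?norm2_ge0 //.
by rewrite real_normK ?num_real // exprMn !norm2_sqr dot_sqr_le.
Qed.

Lemma norm2D_le n (v w : 'cV[R]_n) : norm2 (v + w) <= norm2 v + norm2 w.
Proof.
rewrite norm2_le ?addr_ge0 ?norm2_ge0 // !dotE (dotC w v).
by have := dot_le v w; rewrite sqrrD !norm2_sqr; lra.
Qed.

(** * Frobenius and spectral norms *)

Lemma normF_ge0 m n (A : 'M[R]_(m, n)) : 0 <= normF A.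
Proof. exact: sqrtr_ge0. Qed.

Lemma normF_sqr m n (A : 'M[R]_(m, n)) :
  normF A ^+ 2 = \sum_i \sum_j A i j ^+ 2.
Proof.
by rewrite sqr_sqrtr // sumr_ge0 // => i _; rewrite sumr_ge0 // => j _;
  rewrite sqr_ge0.
Qed.

Lemma normF_tr m n (A : 'M[R]_(m, n)) : normF A^T = normF A.
Proof.
rewrite /normF exchange_big /=; congr Num.sqrt.
by apply: eq_bigr => i _; apply: eq_bigr => j _; rewrite mxE.
Qed.

Lemma norm2_mulmx_normF m n (A : 'M[R]_(m, n)) v :
  norm2 (A *m v) <= normF A * norm2 v.
Proof.
rewrite norm2_le ?mulr_ge0 ?normF_ge0 ?norm2_ge0 //.
rewrite exprMn normF_sqr norm2_sqr mulr_suml /dot; apply: ler_sum => i _.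
have -> : (A *m v) i 0 = dot (row i A)^T v.
  by rewrite mxE; apply: eq_bigr => j _; rewrite !mxE.
rewrite -expr2 (le_trans (dot_sqr_le _ _)) //.
rewrite ler_wpM2r ?dotvv_ge0 //.
by rewrite /dot; apply: ler_sum => j _; rewrite !mxE expr2.
Qed.

Lemma spectral_norm_set_has_ubound m n (A : 'M[R]_(m, n)) :
  has_ubound [set norm2 (A *m v) | v in [set v : 'cV[R]_n | norm2 v <= 1]]%classic.
Proof.
exists (normF A) => _ [v /= v1 <-].
apply: le_trans (norm2_mulmx_normF A v) _.
by rewrite ler_piMr ?normF_ge0.
Qed.

Lemma spectral_norm_ge0 m n (A : 'M[R]_(m, n)) : 0 <= spectral_norm A.
Proof.
apply: (ub_le_sup (spectral_norm_set_has_ubound A)); exists 0 => /=.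
  by rewrite norm2_0 ler01.
by rewrite mulmx0 norm2_0.
Qed.

Lemma norm2_mulmx_le m n (A : 'M[R]_(m, n)) v :
  norm2 (A *m v) <= spectral_norm A * norm2 v.
Proof.
have [->|v0] := eqVneq v 0; first by rewrite mulmx0 !norm2_0 mulr0.
have nv := norm2_gt0 v0.
rewrite -ler_pdivrMr // mulrC.
apply: (ub_le_sup (spectral_norm_set_has_ubound A)).
have vi : `|(norm2 v)^-1| = (norm2 v)^-1 by rewrite ger0_norm ?invr_ge0 ?norm2_ge0.
exists ((norm2 v)^-1 *: v) => /=; first by rewrite norm2Z vi mulVf ?gt_eqF.
by rewrite -scalemxAr norm2Z vi.
Qed.

Lemma spectral_norm_le m n (A : 'M[R]_(m, n)) K :
  0 <= K -> (forall v, norm2 (A *m v) <= K * norm2 v) -> spectral_norm A <= K.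
Proof.
move=> K0 AK; apply: ge_sup.
  by exists (norm2 (A *m 0)), 0 => //=; rewrite norm2_0 ler01.
move=> _ [v /= v1 <-]; apply: le_trans (AK v) _.
by rewrite ler_piMr.
Qed.

Lemma norm2_mul_trmx_le m n (A : 'M[R]_(m, n)) w :
  norm2 (A^T *m w) <= spectral_norm A * norm2 w.
Proof.
have [->|w0] := eqVneq (A^T *m w) 0.
  by rewrite norm2_0 mulr_ge0 ?spectral_norm_ge0 ?norm2_ge0.
rewrite -(ler_pM2r (norm2_gt0 w0)) -expr2 norm2_sqr -dot_adjoint.
apply: le_trans (dot_le _ _) _.
have := norm2_mulmx_le A (A^T *m w); have := norm2_ge0 w; nra.
Qed.

(** The squared Frobenius norm is the sum of the [n] numbers [|A e_j|^2], each
    at most [|A|^2].  The bound with [n] in place of [sqrt n] is kept because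
    it is a polynomial in [n]. *)
Lemma normF_le_spectral_norm m n (A : 'M[R]_(m, n)) :
  normF A <= n%:R * spectral_norm A.
Proof.
have s0 := spectral_norm_ge0 A.
rewrite -(ler_pXn2r (n := 2)) ?nnegrE ?mulr_ge0 ?normF_ge0 //.
rewrite normF_sqr exchange_big /=.
apply: (@le_trans _ _ (\sum_(j < n) spectral_norm A ^+ 2)).
  apply: ler_sum => j _.
  have -> : \sum_i A i j ^+ 2 = norm2 (A *m delta_mx j 0) ^+ 2.
    rewrite norm2_sqr -colE; apply: eq_bigr => i _.
    by rewrite !mxE expr2.
  rewrite ler_pXn2r ?nnegrE ?norm2_ge0 //.
  apply: le_trans (norm2_mulmx_le _ _) _.
  rewrite ler_piMr // norm2_le ?ler01 // /dot (bigD1 j) //= big1.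
    by rewrite !mxE !eqxx mulr1 addr0 expr1n.
  by move=> i ij; rewrite !mxE (negbTE ij) mul0r.
rewrite sumr_const card_ord -[leLHS]mulr_natl exprMn ler_wpM2r ?sqr_ge0 //.
by rewrite -natrX ler_nat; case: n {A s0} => // n; rewrite expnS expn1 leq_pmulr.
Qed.

(** * Singular values *)

Lemma singular_vector m n (A : 'M[R]_(m, n)) s : eigenvalue (A^T *m A) (s ^+ 2) ->
  exists2 v : 'cV[R]_n, norm2 v = 1 & A^T *m (A *m v) = s ^+ 2 *: v.
Proof.
move=> /eigenvalueP[w wG w0].
have w0' : w^T != 0 by rewrite -(inj_eq trmx_inj) trmxK trmx0.
have nw := norm2_gt0 w0'.
exists ((norm2 w^T)^-1 *: w^T).
  by rewrite norm2Z ger0_norm ?invr_ge0 ?norm2_ge0 // mulVf ?gt_eqF.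
rewrite mulmxA -scalemxAr.
by rewrite -[A^T *m A]trmxK trmx_mul trmxK -trmx_mul wG linearZ /= !scalerA mulrC.
Qed.

Lemma norm2_singular_vector m n (A : 'M[R]_(m, n)) s (v : 'cV[R]_n) :
  0 <= s -> norm2 v = 1 -> A^T *m (A *m v) = s ^+ 2 *: v -> norm2 (A *m v) = s.
Proof.
move=> s0 v1 Av; apply/eqP; rewrite -(eqrXn2 (n := 2)) ?norm2_ge0 //.
by rewrite norm2_sqr dot_adjoint Av dotZr -norm2_sqr v1 expr1n mulr1.
Qed.

(** The value [|A|^2] is attained by the Rayleigh quotient of [A^T A].  The
    matrix [M = |A|^2 - A^T A] has form [q w = |A|^2 |w|^2 - |A w|^2 >= 0]
    with [q w <= |A|^2 |w|^2].  Nonnegativity at [w - t M w], with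
    [t = 1 / |A|^2], yields [|M w|^2 <= |A|^2 q w].  If [M] had an inverse [N],
    then [|w|^2 <= K q w] with [K = 1 + |N|_F^2 |A|^2], that is,
    [|A w|^2 <= (|A|^2 - 1/K) |w|^2] for all [w], against the minimality of
    [|A|]. *)
Lemma spectral_norm_eigenvalue m n (A : 'M[R]_(m, n)) :
  (0 < n)%N -> eigenvalue (A^T *m A) (spectral_norm A ^+ 2).
Proof.
case: n A => // n A _; set s := spectral_norm A; set G := A^T *m A.
have s0 : 0 <= s by exact: spectral_norm_ge0.
pose M := s ^+ 2 *: 1%:M - G.
have ME (w : 'cV[R]_n.+1) : M *m w = s ^+ 2 *: w - A^T *m (A *m w).
  by rewrite mulmxBl -scalemxAl mul1mx mulmxA.
have q_ge0 (w : 'cV[R]_n.+1) : dot (A *m w) (A *m w) <= s ^+ 2 * dot w w.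
  rewrite -!norm2_sqr -exprMn ler_pXn2r ?nnegrE ?mulr_ge0 ?norm2_ge0 //.
  exact: norm2_mulmx_le.
have MM_le (w : 'cV[R]_n.+1) : dot (M *m w) (M *m w) <=
    s ^+ 2 * (s ^+ 2 * dot w w - dot (A *m w) (A *m w)).
  have [s_eq0|s_neq0] := eqVneq s 0.
    (* For [s = 0] the step [t = 1 / s^2] is meaningless, but then [A = 0]. *)
    have Aw0 : A *m w = 0.
      apply/dotvv_eq0/le_anti; rewrite dotvv_ge0 andbT.
      by have := q_ge0 w; rewrite s_eq0 expr0n mul0r.
    by rewrite ME Aw0 s_eq0 expr0n /= scale0r mulmx0 subr0 -(scale0r 0) dotZl !mul0r.
  have s2 : 0 < s ^+ 2 by rewrite exprn_gt0 // lt_neqAle eq_sym s_neq0.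
  set z := M *m w.
  have Awz : dot (A *m w) (A *m z) = s ^+ 2 * dot w z - dot z z.
    rewrite dotC dot_adjoint dotC.
    have -> : A^T *m (A *m w) = s ^+ 2 *: w - z by rewrite /z ME opprB addrC subrK.
    by rewrite !dotE.
  have wz : dot w z = s ^+ 2 * dot w w - dot (A *m w) (A *m w).
    by rewrite /z ME !dotE -dot_adjoint.
  (* The vector [w - t z], scaled by [s^2] to clear the denominator of [t]. *)
  have := q_ge0 (s ^+ 2 *: w - z).
  rewrite mulmxBr -scalemxAr !dotE (dotC z w) (dotC (A *m z)) Awz wz.
  set a := dot w w; set b := dot (A *m w) _; set c := dot z z.
  have := dotvv_ge0 (A *m z); set d := dot (A *m z) _.
  move: s2; set S := s ^+ 2 => S0 d0 h.
  rewrite -(ler_pM2l S0); nra.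
apply: contraT; rewrite negbK => /eqP kerG.
have unitM : G - (s ^+ 2)%:M \in unitmx.
  by rewrite -row_free_unit -kermx_eq0; apply/eqP.
pose N := - invmx (G - (s ^+ 2)%:M).
have NM : N *m M = 1%:M.
  by rewrite /M scalemx1 -opprB mulmxN mulNmx opprK mulVmx.
pose K := 1 + normF N ^+ 2 * s ^+ 2.
have K0 : 0 < K by rewrite ltr_pwDl // mulr_ge0 ?sqr_ge0.
have q_lower (w : 'cV[R]_n.+1) :
    dot (A *m w) (A *m w) <= (s ^+ 2 - K^-1) * dot w w.
  rewrite mulrBl lerBrDr addrC -lerBrDr ler_pdivrMl //.
  have := norm2_mulmx_normF N (M *m w); rewrite mulmxA NM mul1mx.
  rewrite norm2_le ?mulr_ge0 ?normF_ge0 ?norm2_ge0 // exprMn norm2_sqr => h.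
  apply: le_trans h _.
  have := MM_le w; have := q_ge0 w; have := sqr_ge0 (normF N); rewrite /K; nra.
have e0 : const_mx 1 != 0 :> 'cV[R]_n.+1.
  by apply/eqP => /matrixP/(_ 0 0); rewrite !mxE => /eqP; rewrite oner_eq0.
have sK : 0 <= s ^+ 2 - K^-1.
  have := le_trans (dotvv_ge0 _) (q_lower (const_mx 1)).
  by rewrite pmulr_lge0 // -norm2_sqr exprn_gt0 ?norm2_gt0.
have : s <= Num.sqrt (s ^+ 2 - K^-1).
  apply: spectral_norm_le; first exact: sqrtr_ge0.
  move=> w; rewrite norm2_le ?mulr_ge0 ?sqrtr_ge0 ?norm2_ge0 //.
  by rewrite exprMn sqr_sqrtr // norm2_sqr.
rewrite -(ler_pXn2r (n := 2)) ?nnegrE ?sqrtr_ge0 // sqr_sqrtr //.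
by have := K0; rewrite -invr_gt0; lra.
Qed.

Lemma sigma_max_spectral_norm m n (A : 'M[R]_(m, n)) :
  (0 < n)%N -> sigma_max A = spectral_norm A.
Proof.
move=> n0; have top : singular_values A (spectral_norm A).
  by split; [exact: spectral_norm_ge0 | exact: spectral_norm_eigenvalue].
have ub : ubound (singular_values A) (spectral_norm A).
  move=> s [s0 /singular_vector[v v1 Av]].
  rewrite -(norm2_singular_vector s0 v1 Av).
  by rewrite (le_trans (norm2_mulmx_le A v)) // v1 mulr1.
apply/le_anti/andP; split; first by apply: ge_sup ub; exists (spectral_norm A).
by apply: ub_le_sup top; exists (spectral_norm A).
Qed.

(** A left inverse [B] of [A] gives [1 = |v| <= |B|_F |A v|] for every unit
    vector [v], which bounds all singular values away from [0]. *)
Lemma sigma_min_gt0 m n (A : 'M[R]_(m, n)) :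
  (0 < n)%N -> \rank A = n -> 0 < sigma_min A.
Proof.
move=> n0 rA; have /row_fullP[B BA] : row_full A by rewrite /row_full rA.
have K0 : 0 < 1 + normF B by rewrite ltr_pwDl ?normF_ge0.
apply: (@lt_le_trans _ _ (1 + normF B)^-1); first by rewrite invr_gt0.
apply: lb_le_inf.
  exists (spectral_norm A); split; first exact: spectral_norm_ge0.
  exact: spectral_norm_eigenvalue.
move=> s [s0 /singular_vector[v v1 Av]].
have Bv := norm2_mulmx_normF B (A *m v).
rewrite mulmxA BA mul1mx v1 (norm2_singular_vector s0 v1 Av) in Bv.
rewrite -div1r ler_pdivrMr // (le_trans Bv) // mulrC ler_wpM2l //.
by rewrite lerDr ler01.
Qed.

(** Both ends of the spectrum are singular values, so the ratio is at least
    [1] as soon as the smaller one is nonzero. *)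
Lemma cond_ge1 m n (A : 'M[R]_(m, n)) :
  (0 < n)%N -> \rank A = n -> 1 <= cond A.
Proof.
move=> n0 rA; rewrite /cond ler_pdivlMr ?sigma_min_gt0 // mul1r.
rewrite sigma_max_spectral_norm //; apply: ge_inf; first by exists 0 => s [].
by split; [exact: spectral_norm_ge0 | exact: spectral_norm_eigenvalue].
Qed.

(** * Least squares *)

(** First-order optimality in the direction of the gradient [g = A^T r] of the
    residual [r]: for all [t], [|r|^2 <= |r - t A g|^2], so that
    [2 t |g|^2 <= t^2 |A g|^2].  The step [t = |g|^2 / (1 + |A g|^2)] forces
    [g = 0]. *)
Lemma ls_solution_normal_eq m n (A : 'M[R]_(m, n)) b x :
  ls_solution A b x -> A^T *m (b - A *m x) = 0.
Proof.
move=> lsx; set r := b - A *m x.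
have lsr z : norm2 r <= norm2 (r - A *m z).
  by rewrite /r -addrA -opprD -mulmxDr; exact: lsx.
clearbody r; set g := A^T *m r.
apply: dotvv_eq0; set a := dot g g; set B := dot (A *m g) (A *m g).
have a0 : 0 <= a := dotvv_ge0 g.
have B0 : 0 <= B := dotvv_ge0 (A *m g).
have B1 : 0 < 1 + B by rewrite ltr_pwDl.
pose t := a / (1 + B).
have tE : t * (1 + B) = a by rewrite /t divfK ?gt_eqF.
have := lsr (t *: g); rewrite -scalemxAr norm2_le ?norm2_ge0 // norm2_sqr.
rewrite !dotE (dotC r (A *m g)) dot_adjoint -/g -/a -/B => h.
have t0 : 0 <= t by rewrite divr_ge0 // ltW.
nra.
Qed.

(** The comparison of the perturbed residual with [b] is what keeps the bound
    free of [x] and of [cond A]: it uses only that [xh] is optimal for [A + D]. *)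
Lemma residual_le_perturbation m n (A D : 'M[R]_(m, n)) b xh :
  ls_solution (A + D) b xh ->
  norm2 (A^T *m (b - A *m xh)) <=
    normF D * (norm2 b + spectral_norm A * norm2 xh).
Proof.
move=> lsD; have := ls_solution_normal_eq lsD.
set r := b - (A + D) *m xh => ADr.
have rb : norm2 r <= norm2 b by have := lsD 0; rewrite mulmx0 subr0.
have -> : b - A *m xh = r + D *m xh by rewrite /r mulmxDl opprD addrA subrK.
clearbody r; move/eqP: ADr.
rewrite [(A + D)^T]linearD /= mulmxDl addr_eq0 => /eqP Ar.
rewrite mulmxDr Ar addrC.
apply: le_trans (norm2D_le _ _) _; rewrite norm2N.
have h1 := le_trans (norm2_mul_trmx_le A (D *m xh))
  (ler_wpM2l (spectral_norm_ge0 A) (norm2_mulmx_normF D xh)).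
have h2 := le_trans (norm2_mulmx_normF D^T r)
  (ler_wpM2l (normF_ge0 _) rb).
move: h2; rewrite normF_tr; lra.
Qed.

(** Passing to the infimum over the admissible perturbations, a set that
    contains [- A]. *)
Lemma residual_le_backward_error m n (A : 'M[R]_(m, n)) b xh :
  norm2 (A^T *m (b - A *m xh)) <=
    backward_error A b xh * (norm2 b + spectral_norm A * norm2 xh).
Proof.
set N := norm2 _; set T := norm2 b + _.
have T0 : 0 <= T.
  by rewrite addr_ge0 ?mulr_ge0 ?norm2_ge0 ?spectral_norm_ge0.
have lsNA : ls_solution (A - A) b xh by move=> z; rewrite subrr !mul0mx.
have [TE|TN] := eqVneq T 0.
  by have := residual_le_perturbation lsNA; rewrite -/T TE !mulr0.
have Tp : 0 < T by rewrite lt_neqAle eq_sym TN.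
rewrite -ler_pdivrMr //; apply: lb_le_inf; first by exists (normF (- A)), (- A).
by move=> _ [D /= lsD <-]; rewrite ler_pdivrMr // residual_le_perturbation.
Qed.

Lemma backward_error_ge0 m n (A : 'M[R]_(m, n)) b xh : 0 <= backward_error A b xh.
Proof.
apply: lb_le_inf; last by move=> _ [D _ <-]; exact: normF_ge0.
by exists (normF (- A)), (- A) => // z; rewrite subrr !mul0mx.
Qed.

Lemma norm2_cV0 (v : 'cV[R]_0) : norm2 v = 0.
Proof. by rewrite (flatmx0 v) norm2_0. Qed.

Lemma spectral_norm_no_columns m (A : 'M[R]_(m, 0)) : spectral_norm A = 0.
Proof.
apply/le_anti; rewrite spectral_norm_ge0 andbT.
apply: spectral_norm_le => // v.
by rewrite (flatmx0 v) mulmx0 !norm2_0 mulr0.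
Qed.

(** The prefactor [c(m, n)] becomes [n c(m, n)], through [|A|_F <= n |A|].
    The sign of [c(m, n)] is not known, but a backward error is nonnegative: so
    [c(m, n) < 0] can only happen with [|A|_F = 0], when both sides vanish. *)
Lemma backward_stable_residual (c : {poly {poly R}}) m n (A : 'M[R]_(m, n))
    (b : 'cV[R]_m) (xh : 'cV[R]_n) (u : R) :
  0 < u -> backward_stable c u A b xh ->
  lesssim (c * 'X%:P) m n (norm2 (A^T *m (b - A *m xh)))
    (spectral_norm A * (norm2 b + spectral_norm A * norm2 xh) * u).
Proof.
move=> u0; rewrite /backward_stable /lesssim hornerM hornerC hornerM hornerX.
set C := c.[_].[_] => be.
have be0 := backward_error_ge0 A b xh.
have res := residual_le_backward_error A b xh.
have F0 := normF_ge0 A; have Fn := normF_le_spectral_norm A.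
set T := norm2 b + _ in res *.
have T0 : 0 <= T.
  by rewrite addr_ge0 ?mulr_ge0 ?norm2_ge0 ?spectral_norm_ge0.
apply: le_trans res _.
have -> : C * n%:R * (spectral_norm A * T * u) =
  C * (n%:R * spectral_norm A) * u * T by ring.
apply: ler_wpM2r => //; rewrite (le_trans be) // mulrA.
apply: ler_wpM2r; first exact: ltW.
have [C0|C0] := leP 0 C; first exact: ler_wpM2l.
suff A0 : normF A = 0.
  have -> : spectral_norm A = 0; last by rewrite A0 !mulr0.
  apply/le_anti; rewrite spectral_norm_ge0 andbT.
  apply: spectral_norm_le => // w.
  by rewrite -A0 norm2_mulmx_normF.
apply/le_anti; rewrite F0 andbT.
have := le_trans be0 be.
by rewrite mulrA pmulr_lge0 // nmulr_rge0.
Qed.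

(** * Strongly forward stable solutions with a large normal-equation residual *)

(** The step [t] along the top singular vector is the largest one that the
    bound on [|A (x - xh)|] allows up to the constant [2.23]; the bound on
    [|x - xh|] is weaker by the factor [cond A], which is why [1 <= cond A] is
    all that it requires. *)
Lemma strongly_forward_stable_large_residual m n (A : 'M[R]_(m, n))
    (b : 'cV[R]_m) (x : 'cV[R]_n) (u : R) :
  \rank A = n -> 0 < u -> ls_solution A b x ->
  exists xh : 'cV[R]_n, strongly_forward_stable 1 u A b x xh /\
    norm2 (A^T *m (b - A *m xh)) = spectral_norm A *
      (spectral_norm A * norm2 x + cond A * norm2 (b - A *m x)) * u.
Proof.
move=> rA u0 lsx; case: n => [|n] in A x rA lsx *.
  (* Without columns, [x + t v] is not available, but all norms vanish. *)
  exists x; split; last by rewrite norm2_cV0 spectral_norm_no_columns !mul0r.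
  exists 0; rewrite /lesssim !hornerC mul1r ltW // subrr mulmx0 !norm2_0 !mulr0.
  by split.
set s := spectral_norm A; set r := b - A *m x; set k := cond A.
have [v v1 Av] := singular_vector (spectral_norm_eigenvalue A (ltn0Sn n)).
have s0 : 0 <= s := spectral_norm_ge0 A.
have k1 : 1 <= k := cond_ge1 (ltn0Sn n) rA.
have sp : 0 < s.
  rewrite lt_neqAle s0 andbT eq_sym; apply: contraTneq k1 => sE.
  by rewrite /k /cond sigma_max_spectral_norm // -/s sE mul0r ler10.
have Avs : norm2 (A *m v) = s := norm2_singular_vector s0 v1 Av.
pose T := norm2 x + k / s * norm2 r; pose t := T * u.
have T0 : 0 <= T.
  rewrite addr_ge0 ?norm2_ge0 // mulr_ge0 ?norm2_ge0 // divr_ge0 //.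
  exact: le_trans k1.
have t0 : 0 <= t by rewrite mulr_ge0 // ltW.
have sT : s * norm2 x + k * norm2 r = s * T by rewrite /T; field; rewrite gt_eqF.
exists (x + t *: v); split; last first.
  rewrite sT [A *m (x + _)]mulmxDr opprD addrA mulmxBr.
  rewrite ls_solution_normal_eq // sub0r.
  rewrite -!scalemxAr Av norm2N !norm2Z v1 -/s ger0_norm // ger0_norm ?sqr_ge0 //.
  by rewrite /t; ring.
exists u; have -> : x - (x + t *: v) = - (t *: v) by rewrite opprD addrA subrr sub0r.
rewrite /lesssim !hornerC mul1r lexx mulmxN -scalemxAr !norm2N !norm2Z v1 Avs.
rewrite -/s -/k -/r -/T sT ger0_norm // mulr1; split=> //.
  rewrite /t; apply: ler_wpM2r; first exact: ltW.
  by apply: ler_peMl => //; lra.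
have : 0 <= t * s by rewrite mulr_ge0.
by rewrite /t; lra.
Qed.

End Euclidean.

Theorem corollary1p2 (R : realType) :
  (forall c : {poly {poly R}}, exists c' : {poly {poly R}},
    forall (m n : nat) (A : 'M[R]_(m, n)) (b : 'cV[R]_m) (xh : 'cV[R]_n)
      (u : R),
    (n <= m)%N -> \rank A = n -> 0 < u ->
    backward_stable c u A b xh ->
    lesssim c' m n
      (norm2 (A^T *m (b - A *m xh)))
      (spectral_norm A * (norm2 b + spectral_norm A * norm2 xh) * u))
  /\
  (exists c c' : {poly {poly R}},
    forall (m n : nat) (A : 'M[R]_(m, n)) (b : 'cV[R]_m) (x : 'cV[R]_n)
      (u : R),
    (n <= m)%N -> \rank A = n -> 0 < u ->
    ls_solution A b x ->
    exists xh : 'cV[R]_n,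
      strongly_forward_stable c u A b x xh /\
      lesssim c' m n
        (spectral_norm A *
          (spectral_norm A * norm2 x + cond A * norm2 (b - A *m x)) * u)
        (norm2 (A^T *m (b - A *m xh)))).
Proof.
split=> [c|].
  exists (c * 'X%:P) => m n A b xh u _ _.
  exact: backward_stable_residual.
exists 1, 1 => m n A b x u _ rA u0 lsx.
have [xh [sfs resE]] := strongly_forward_stable_large_residual rA u0 lsx.
by exists xh; split=> //; rewrite /lesssim !hornerC mul1r resE.
Qed.
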